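(* Let $n\ge1$, $N\ge1$ and let $p_1,\dots,p_n\in\{0,1,\dots,N\}$ with $p_1+p_2+\cdots+p_n\le N$. Consider the $n$-type TASEP on $\mathbb{Z}_N$ with $p_m$ particles of type $m$, for $m=1,\dots,n$, and let $$M=\binom{N}{p_1}\binom{N}{p_1+p_2}\cdots\binom{N}{p_1+p_2+\cdots+p_n}.$$ (i) In the stationary distribution, the probability of any state is an integer multiple of $M^{-1}$. (ii) A state $u$ (with $p_m$ particles of type $m$ for each $m$) has probability $M^{-1}$ (the smallest possible) in the stationary distribution if and only if the following holds for each $j\in\mathbb{Z}_N$: if $u(j)=\infty$ then $u(j+1)=\infty$ or $u(j+1)=n$, while if $u(j)=m<\infty$ then $u(j+1)\ge m-1$.
   Context: $\mathbb{Z}_N$ is the cycle of integers mod $N$. Configurations of the $n$-type TASEP on $\mathbb{Z}_N$ are elements $u\in(\{1,2,\dots,n\}\cup\{\infty\})^{\mathbb{Z}_N}$, with the order $1<2<\cdots<n<\infty$; $u(i)=r\le n$ means there is a particle of class (type) $r$ at $i$, and $u(i)=\infty$ means there is a hole at $i$. Dynamics: bells ring at each site as independent Poisson processes of rate 1; when the bell at site $i$ rings, the values $u(i-1)$ and $u(i)$ are replaced by $\min\{u(i-1),u(i)\}$ and $\max\{u(i-1),u(i)\}$ respectively, all other values being unchanged. The number of particles of each type is conserved; the state space of the process with $p_m$ particles of type $m$ is the set of $u$ having exactly $p_m$ sites with value $m$ for each $m=1,\dots,n$, and the stationary distribution referred to is the unique stationary distribution concentrated on this set. *)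

(* Defs.v *)
From mathcomp Require Import all_boot all_order all_algebra.
From mathcomp Require Import all_classical all_reals all_analysis.

Set Implicit Arguments.
Unset Strict Implicit.
Unset Printing Implicit Defensive.

Import Order.TTheory GRing.Theory Num.Theory.
Import numFieldNormedType.Exports.

Local Open Scope ring_scope.

(* The value set {1 < ... < n < oo} is encoded by 'I_n.+1 with its usual order:
   the ordinal k < n stands for class k + 1, and ord_max for a hole. *)
Definition value (n : nat) : finType := 'I_n.+1.

Definition hole (n : nat) : value n := ord_max.

(* [class m] is the value of a particle of class m + 1. *)
Definition class (n : nat) (m : 'I_n) : value n := widen_ord (leqnSn n) m.

(* The label of class k is k; holes get the label n + 1. *)
Definition label (n : nat) (x : value n) : nat := (nat_of_ord x).+1.

(* Sites of the cycle Z_N are 'I_N; [ordS] and [ord_pred] are i + 1 and i - 1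
   modulo N. *)
Definition conf (n N : nat) : finType := {ffun 'I_N -> value n}.

Definition ring_bell (n N : nat) (i : 'I_N) (u : conf n N) : conf n N :=
  [ffun k => if k == ord_pred i then Order.min (u (ord_pred i)) (u i)
             else if k == i then Order.max (u (ord_pred i)) (u i)
             else u k].

Definition state_space (n N : nat) (p : 'I_n -> nat) : {set conf n N} :=
  [set u : conf n N | [forall m : 'I_n, #|[set i | u i == class m]| == p m]].

(* Action mu |-> mu Q on measures of the generator Q of the process: each site
   contributes a jump from u to ring_bell i u at rate 1. *)
Definition gen (R : realType) (n N : nat) (mu : conf n N -> R) : conf n N -> R :=
  fun v => \sum_(i < N) (\sum_(u | ring_bell i u == v) mu u - mu v).

(* mu e^{tQ}, the law at time t of the process started from the law mu. *)
Definition law_at (R : realType) (n N : nat) (mu : conf n N -> R) (t : R) :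
    conf n N -> R :=
  fun v => limn (series (fun k => t ^+ k / k`!%:R * iter k (@gen R n N) mu v)).

Definition stationary_distribution (R : realType) (n N : nat) (p : 'I_n -> nat)
    (mu : conf n N -> R) : Prop :=
  [/\ forall u, 0 <= mu u,
      \sum_u mu u = 1,
      forall u, u \notin state_space N p -> mu u = 0
    & forall t : R, 0 <= t -> forall u, law_at mu t u = mu u].

Definition M (n N : nat) (p : 'I_n -> nat) : nat :=
  (\prod_(k < n) 'C(N, \sum_(m < n | m <= k) p m))%N.

(* Main.v *)
(* Multiline queues.  A configuration of an n-type system is read as the arrivals
   at a queue on the ring (arrivals of class at most k, for each threshold k), and
   a set S of sites as its services; the departures form a configuration of an
   (n+1)-type system.  A bell at i on the departures is produced by a bell at i on
   S together with a bell on the arrivals at i if i is in S, and at i + 1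
   otherwise; this correspondence of pairs (site, S) is a bijection, so pushing
   forward (invariant weight on arrivals) x (counting measure on S) gives again an
   invariant weight.  Inductively, the stationary probability of u is the number
   of multiline queues producing u, divided by the number M of all of them.

   Every u is produced by the arrivals obtained by merging its class n with the
   holes, where no customer ever waits.  A violation of the descent condition
   created at the last step yields a second preimage, in which one customer
   arrives one site earlier; conversely the condition forbids waiting, and then
   the preimage is unique. *)

Require Import Defs.
From mathcomp Require Import all_boot all_order all_algebra.
From mathcomp Require Import all_classical all_reals all_analysis.
From mathcomp Require Import fingroup perm zify ring lra.

Set Implicit Arguments.
Unset Strict Implicit.
Unset Printing Implicit Defensive.

Import Order.TTheory GRing.Theory Num.Theory.
Import numFieldNormedType.Exports.

Local Open Scope nat_scope.

(** * Queues on the ring *)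

Lemma val_iter_ordS N k (i : 'I_N) : iter k (@ordS N) i = (i + k) %% N :> nat.
Proof.
elim: k => [|k IH] /=; first by rewrite addn0 modn_small.
by rewrite IH -addn1 modnDml addn1 addnS.
Qed.

Lemma iter_ordS_pred N k (i : 'I_N) :
  iter k (@ordS N) (iter k (@ord_pred N) i) = i.
Proof. by elim: k i => // k IH i; rewrite iterS iterSr IH ord_predK. Qed.

Lemma cycle_ind N (P : 'I_N -> Prop) (i : 'I_N) :
  (forall j, P (ord_pred j) -> P j) -> P i -> forall j, P j.
Proof.
move=> step Pi j.
have -> : j = iter (j + N - i) (@ordS N) i.
  apply: val_inj; rewrite /= val_iter_ordS.
  rewrite subnKC ?modnDr ?modn_small //.
  by rewrite (leq_trans (ltnW (ltn_ord i))) ?leq_addl.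
elim: (j + N - i) => //= k IH; apply: step; by rewrite ordSK.
Qed.

Lemma iter_ord_pred_inj N (i : 'I_N) :
  injective (fun k : 'I_N => iter k (@ord_pred N) i).
Proof.
move=> k k' /= e.
have := iter_ordS_pred k i; have := iter_ordS_pred k' i; rewrite -e => e1 e2.
have : iter k (@ordS N) (iter k (@ord_pred N) i) =
       iter k' (@ordS N) (iter k (@ord_pred N) i) by rewrite e1 e2.
move/(congr1 (@nat_of_ord N)); rewrite !val_iter_ordS => /eqP.
by rewrite eqn_modDl !modn_small // => /eqP /val_inj.
Qed.

(** A monotone family of bits encodes one number, the first index at which it holds. [mq] uses this
    to rebuild a value from its thresholds. *)
Lemma sum_negb_leq n (b : 'I_n -> bool) (k : 'I_n) :
  (forall i j : 'I_n, i <= j -> b i -> b j) ->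
  (\sum_(i < n) ~~ b i <= k) = b k.
Proof.
move=> bmono; rewrite (bigID (fun i : 'I_n => i < k)) /=.
have card_lt : forall m, m <= n -> \sum_(i < n | i < m) 1 = m.
  move=> m le_mn; rewrite -(big_ord_widen n (fun=> 1) le_mn).
  by rewrite sum1_card card_ord.
case: (boolP (b k)) => bk.
  rewrite [X in _ + X]big1 ?addn0; last first.
    by move=> i; rewrite -leqNgt => /bmono -> .
  rewrite -[X in _ <= X](card_lt k (ltnW (ltn_ord k))).
  by apply: leq_sum => i _; case: (b i).
apply/negbTE; rewrite -ltnNge -[X in X < _](card_lt k (ltnW (ltn_ord k))).
have nb : forall i : 'I_n, i <= k -> b i = false.
  by move=> i le_ik; apply: contraNF bk; apply: bmono.
rewrite -addn1 leq_add //; first by apply: leq_sum => i /ltnW /nb ->.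
by rewrite (bigD1 k) ?ltnn //= nb.
Qed.

Section Queue.

Variable N : nat.
Implicit Types (A S : 'I_N -> bool) (q : 'I_N -> nat).

Definition window A l i := \sum_(k < l) A (iter k (@ord_pred N) i).

Lemma windowS A l i : window A l.+1 i = A i + window A l (ord_pred i).
Proof.
rewrite /window big_ord_recl /=; congr (_ + _).
by apply: eq_bigr => k _; rewrite -iterS iterSr.
Qed.

Lemma window_cycle A i : window A N i = \sum_j A j.
Proof.
rewrite /window [RHS](reindex_inj (@iter_ord_pred_inj N i)).
by [].
Qed.

(** Loynes' formula for the queue length: the largest excess of arrivals over services in a window
    ending at [i]. One turn of the cycle suffices when arrivals do not outnumber services. *)
Definition backlog A S i :=
  \max_(l < N.+1) (window A l i - window S l i).

Definition queue A S q := forall j, q j = q (ord_pred j) + A j - S j.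

Definition departs A S q j := S j && (0 < q (ord_pred j) + A j).

Definition served A S := departs A S (backlog A S).

Lemma backlog_queue A S :
  \sum_j A j <= \sum_j S j -> queue A S (backlog A S).
Proof.
move=> leAS j; apply/eqP; rewrite eqn_leq; apply/andP; split.
  apply/bigop.bigmax_leqP => -[[|l] ltl] _ /=; first by rewrite /window !big_ord0.
  rewrite !windowS.
  have ltl' : l < N.+1 by exact: ltnW.
  have := @bigop.leq_bigmax _ (fun l : 'I_N.+1 =>
    window A l (ord_pred j) - window S l (ord_pred j)) (Ordinal ltl').
  rewrite -/(backlog A S (ord_pred j)) /=; lia.
have ub l : l < N.+1 -> window A l j - window S l j <= backlog A S j.
  by move=> ltl; exact: (@bigop.leq_bigmax _ (fun l : 'I_N.+1 =>
    window A l j - window S l j) (Ordinal ltl)).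
have Ngt0 := ltn_ord j.
have base : A j - S j <= backlog A S j.
  by have := ub 1; rewrite !windowS /window !big_ord0; lia.
have [|[l ltl] /= eql] := @bigop.eq_bigmax _ (fun l : 'I_N.+1 =>
    window A l (ord_pred j) - window S l (ord_pred j)).
  by rewrite card_ord.
rewrite -/(backlog A S (ord_pred j)) in eql.
(* A maximal window at [ord_pred j] extends to [j] unless it is already the whole cycle; in that
   case its excess is 0 and [base] suffices. *)
move: ltl; rewrite ltnS leq_eqVlt => /orP[/eqP El|ltl].
  move: eql; rewrite El !window_cycle.
  lia.
have := ub l.+1; rewrite !windowS; lia.
Qed.

(** Summed around the cycle, the queue lengths cancel. *)
Lemma departs_card A S q : queue A S q ->
  \sum_j departs A S q j = \sum_j A j.
Proof.
move=> qq.
have : \sum_j (q j + departs A S q j) = \sum_j (q (ord_pred j) + A j).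
  by apply: eq_bigr => j _; rewrite [q j]qq /departs; case: (S j); lia.
rewrite !big_split /= [\sum_i q i](reindex_inj (@ord_pred_inj N)) /=.
by move/addnI.
Qed.

(** Solutions may differ by a constant when arrivals and services are equally many. The recursion is
    monotone, so an inequality at one site spreads around the cycle; departures are then ordered
    pointwise and have equal totals. *)
Lemma departs_unique A S q q' : queue A S q -> queue A S q' ->
  departs A S q =1 departs A S q'.
Proof.
suff th q1 q2 i : queue A S q1 -> queue A S q2 -> q1 i <= q2 i ->
    departs A S q1 =1 departs A S q2.
  move=> qq qq' j; case: (leqP (q j) (q' j)) => [le|/ltnW le]; first exact: (th _ _ j).
  by apply/esym; exact: (th _ _ j).
move=> qq1 qq2 le12i.
have le12 : forall j, q1 j <= q2 j.
  by apply: cycle_ind le12i => j le; rewrite qq1 qq2; lia.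
have le j : departs A S q1 j <= departs A S q2 j.
  by have := le12 (ord_pred j); rewrite /departs; case: (S j) => //=; lia.
have sums : \sum_j departs A S q1 j = \sum_j departs A S q2 j.
  by rewrite !departs_card.
move=> j; move: sums; rewrite (bigD1 j) //= [RHS](bigD1 j) //=.
have : \sum_(i | i != j) departs A S q1 i <= \sum_(i | i != j) departs A S q2 i.
  by apply: leq_sum.
have := le j; case: departs; case: departs => //=; lia.
Qed.

Lemma eq_served A A' S S' : A =1 A' -> S =1 S' -> served A S =1 served A' S'.
Proof.
move=> eA eS j; rewrite /served /departs eS eA; congr (_ && (0 < _ + _)).
apply: eq_bigr => l _; congr (_ - _); apply: eq_bigr => k _; by rewrite ?eA ?eS.
Qed.

(** Makes the served sets of successive thresholds nested, as [sum_negb_leq] requires. *)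
Lemma served_mono A A' S j : (forall i, A i -> A' i) ->
  served A S j -> served A' S j.
Proof.
move=> sAA' /andP[Sj h]; rewrite /served /departs Sj /=; apply: leq_trans h _.
have le i : A i <= A' i by have := sAA' i; case: (A i) => // ->.
apply: leq_add => //; apply/bigop.bigmax_leqP => l _.
apply: leq_trans (bigop.leq_bigmax l); apply: leq_sub => //; exact: leq_sum.
Qed.

Lemma served_all A S j : (forall i, A i) -> served A S j = S j.
Proof. by move=> allA; rewrite /served /departs allA addn1 andbT. Qed.

Lemma served_card A S : \sum_j A j <= \sum_j S j ->
  \sum_j served A S j = \sum_j A j.
Proof. by move=> leAS; apply: departs_card; exact: backlog_queue. Qed.

Lemma backlog_sub A S j : (forall i, A i -> S i) -> backlog A S j = 0.
Proof.
move=> sAS; apply/eqP; rewrite -leqn0; apply/bigop.bigmax_leqP => l _.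
rewrite leqn0 subn_eq0; apply: leq_sum => k _.
by have := sAS (iter k (@ord_pred N) j); case: (A _) => // ->.
Qed.

Lemma served_sub A S j : (forall i, A i -> S i) -> served A S j = A j.
Proof.
move=> sAS; rewrite /served /departs backlog_sub //.
by have := sAS j; case: (A j) => [->|] //; rewrite andbF.
Qed.

(** A bell seen through a threshold [u <= k]: the minimum becomes a disjunction, the maximum a
    conjunction. *)
Definition bellb (i : 'I_N) A : 'I_N -> bool := fun k =>
  if k == ord_pred i then A (ord_pred i) || A i
  else if k == i then A (ord_pred i) && A i else A k.

Lemma bellb_perm i A : exists s : {perm 'I_N}, bellb i A =1 A \o s.
Proof.
rewrite /bellb.
case: (boolP (A i && ~~ A (ord_pred i))) => [/andP[Ai /negbTE Ap]|h].
  exists (tperm (ord_pred i) i) => k /=; rewrite Ai Ap /=.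
  case: eqP => [->|/eqP np]; first by rewrite tpermL.
  case: eqP => [->|/eqP ni]; first by rewrite tpermR.
  by rewrite tpermD // eq_sym.
exists 1%g => k /=; rewrite perm1.
case: eqP => [->|_]; last case: eqP => [->|//].
  by move: h; case: (A i); case: (A (ord_pred i)).
by move: h; case: (A i); case: (A (ord_pred i)).
Qed.

Lemma bellb_card i A : \sum_j bellb i A j = \sum_j A j.
Proof.
have [s es] := bellb_perm i A.
rewrite [RHS](reindex_inj (@perm_inj _ s)) /=.
by apply: eq_bigr => j _; rewrite es.
Qed.

Definition bell_site S i := if S i then i else ordS i.

(** A single queue length has to change: the one at [ord_pred i] if [i] is a service, the one at [i]
    otherwise. *)
Lemma queue_bell A S q i : queue A S q ->
  exists2 q', queue (bellb (bell_site S i) A) (bellb i S) q' &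
    departs (bellb (bell_site S i) A) (bellb i S) q'
      =1 bellb i (departs A S q).
Proof.
move=> qq.
(* On a one-site cycle every bell is trivial. *)
have [i1|ni1] := eqVneq (ord_pred i) i.
  have all_i : forall j, j = i.
    apply: (@cycle_ind N (fun j => j = i) i) => // j e.
    by apply: (@ord_pred_inj N); rewrite e i1.
  have bid B k j : bellb k B j = B j.
    by rewrite /bellb !(all_i (ord_pred _)) (all_i j) (all_i k) eqxx orbb.
  by exists q => j; rewrite ?bid /departs ?bid.
pose p := ord_pred i.
have inj_pred j : (ord_pred j == p) = (j == i) by rewrite inj_eq //; exact: ord_pred_inj.
have npi : (p == i) = false by apply/negbTE.
have nip : (i == p) = false by rewrite eq_sym; apply/negbTE.
rewrite /bell_site; case: (boolP (S i)) => Si.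
  exists (fun j => if j == p then q (ord_pred p) + (A p || A i) - 1 else q j).
    move=> j; rewrite /bellb -/p inj_pred.
    have [->|njp] := eqVneq j p; first by rewrite npi Si orbT.
    have [->|nji] := eqVneq j i; last exact: qq.
    rewrite [q i]qq [q (ord_pred i)]qq -/p Si.
    by case: (A p); case: (A i); case: (S p) => /=; lia.
  move=> j; rewrite /departs /bellb -/p inj_pred.
  have [->|njp] := eqVneq j p.
    rewrite npi Si orbT [q p]qq.
    by case: (A p); case: (A i); case: (S p) => /=; lia.
  case: ifP => _; last by [].
  rewrite [q p]qq Si.
  by case: (A p); case: (A i); case: (S p) => /=; lia.
have nSi : S i = false by apply/negbTE.
have predS j : (ord_pred j == i) = (j == ordS i).
  by rewrite -[RHS](inj_eq (@ord_pred_inj N)) ordSK.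
have niS : (i == ordS i) = false by rewrite -predS.
(* Without a service at [i], the bell at [i] changes neither services nor departures. The arrival
   bell at [ordS i] can only move a customer back to [i], where it waits one step. *)
exists (fun j => if j == i then q p + (A i || A (ordS i)) else q j).
  move=> j; rewrite /bellb ordSK -/p predS nSi andbF orbF.
  have [->|nji] := eqVneq j i; first by rewrite niS nip subn0.
  have [->|njS] := eqVneq j (ordS i).
    rewrite [q (ordS i)]qq ordSK [q i]qq nSi -/p.
    (* The two neighbours of [i] coincide on a two-site cycle. *)
    have [->|_] := eqVneq (ordS i) p;
    by case: (A i); case: (A _); case: (S _) => /=; lia.
  by have [->|_] := eqVneq j p; exact: qq.
move=> j; rewrite /departs /bellb ordSK -/p predS nSi andbF orbF /= andbF.
have [->|nji] := eqVneq j i; first by rewrite nip.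
have [->|njS] := eqVneq j (ordS i).
  have eqi : q i = q p + A i by rewrite [q i]qq nSi subn0.
  rewrite ordSK; have [e|_] := eqVneq (ordS i) p.
    rewrite -[in ord_pred p]e ordSK eqi e orbF.
    by case: (A i); case: (A p); case: (S p) => /=; lia.
  by rewrite eqi; case: (A i); case: (A _); case: (S _) => /=; lia.
by have [->|_] := eqVneq j p; rewrite ?orbF.
Qed.

(* [departs] does not depend on the solution of the queue equation, so the
   local modification of [queue_bell] may replace the canonical backlog. *)
Lemma served_bell A S i : \sum_j A j <= \sum_j S j ->
  served (bellb (bell_site S i) A) (bellb i S) =1 bellb i (served A S).
Proof.
move=> leAS; have [q' qq' dq'] := queue_bell i (backlog_queue leAS).
move=> j; rewrite -dq'; apply: departs_unique qq' j.
by apply: backlog_queue; rewrite !bellb_card.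
Qed.

End Queue.

(** * One line of a multiline queue, acting on configurations *)

Section Lines.

Variable N : nat.

Definition count_le n (u : conf n N) (k : nat) := \sum_j ((u j : 'I_n.+1) <= k).

Lemma conf_eq n (u v : conf n N) :
  (forall k j, k < n -> (u j <= k) = (v j <= k)) -> u = v.
Proof.
move=> h; apply/ffunP => j; apply: val_inj => /=.
have := ltn_ord (u j); have := ltn_ord (v j).
set a := nat_of_ord (u j); set b := nat_of_ord (v j) => hb ha.
have := h a j; have := h b j; rewrite -/a -/b !leqnn.
case: (ltngtP a b) => // lt.
  move=> _ /(_ (leq_trans lt hb)) /esym; lia.
move=> /(_ (leq_trans lt ha)); lia.
Qed.

Lemma ring_bell_le n (u : conf n N) i j k :
  (ring_bell i u j <= k) = bellb i (fun x => u x <= k) j.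
Proof.
rewrite /ring_bell ffunE /bellb; case: ifP => _.
  by rewrite /Order.min ltEord; case: ifP; lia.
case: ifP => _ //.
by rewrite /Order.max ltEord; case: ifP; lia.
Qed.

Lemma count_le_bell n (u : conf n N) i k : count_le (ring_bell i u) k = count_le u k.
Proof.
rewrite /count_le -[RHS](bellb_card i); apply: eq_bigr => j _; by rewrite ring_bell_le.
Qed.

Definition mq n (v : conf n N) (S : {set 'I_N}) : conf n.+1 N :=
  [ffun j => inord (\sum_(k < n.+1) ~~ served (fun i => v i <= k) (mem S) j)].

Lemma mq_le n (v : conf n N) (S : {set 'I_N}) j k : k <= n ->
  (mq v S j <= k) = served (fun i => v i <= k) (mem S) j.
Proof.
move=> le_kn; rewrite ffunE inordK.
  have := @sum_negb_leq n.+1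
    (fun k : 'I_n.+1 => served (fun i => v i <= k) (mem S) j) (Ordinal (le_kn : k < n.+1)).
  apply=> k1 k2 le12; apply: served_mono => i /leq_trans; exact.
rewrite ltnS -[X in _ <= X]card_ord -sum1_card; apply: leq_sum => i _; exact: leq_b1.
Qed.

Lemma mq_service n (v : conf n N) (S : {set 'I_N}) j : (mq v S j <= n) = (j \in S).
Proof. by rewrite mq_le // served_all // => i; rewrite -ltnS. Qed.

Definition bell_set i (S : {set 'I_N}) := [set j | bellb i (mem S) j].

Lemma sum_mem (S : {set 'I_N}) : \sum_j (j \in S) = #|S|.
Proof. by rewrite -sum1_card [RHS]big_mkcond; apply: eq_bigr => j _; case: (_ \in _). Qed.

Lemma card_bell_set i (S : {set 'I_N}) : #|bell_set i S| = #|S|.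
Proof.
rewrite -!sum_mem -(bellb_card i (mem S)); apply: eq_bigr => j _; by rewrite inE.
Qed.

(** [bell_site] depends on [S] alone, so the same arrival bell serves all thresholds at once. *)
Lemma mq_bell n (v : conf n N) (S : {set 'I_N}) i :
  (forall k, k < n -> count_le v k <= #|S|) ->
  mq (ring_bell (bell_site (mem S) i) v) (bell_set i S) = ring_bell i (mq v S).
Proof.
move=> hv; apply: conf_eq => k j; rewrite ltnS => le_kn.
rewrite ring_bell_le mq_le //.
have -> : bellb i (fun x => mq v S x <= k) j =
          bellb i (served (fun i => v i <= k) (mem S)) j.
  by rewrite /bellb !mq_le.
(* At threshold [n] every site has an arrival and [served_bell] may not apply, but the served set is
   just [S]. *)
move: le_kn; rewrite leq_eqVlt => /orP[/eqP ->|lt_kn].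
  rewrite served_all; last by move=> i'; rewrite -ltnS.
  transitivity (bellb i (mem S) j); first by rewrite -[LHS]/(j \in bell_set i S) inE.
  by rewrite /bellb !served_all // => i'; rewrite -ltnS.
rewrite -served_bell; last by rewrite sum_mem; exact: hv.
apply: eq_served => x; first by rewrite ring_bell_le.
by rewrite -[LHS]/(x \in bell_set i S) inE.
Qed.

Definition bell_pair (x : 'I_N * {set 'I_N}) := (bell_site (mem x.2) x.1, bell_set x.1 x.2).

Lemma bell_set_notin i (S : {set 'I_N}) : i \notin S -> bell_set i S = S.
Proof.
move=> niS; apply/setP => j; rewrite inE /bellb /= (negbTE niS) andbF orbF.
case: eqP => [->//|_]; case: eqP => [->|//]; by rewrite (negbTE niS).
Qed.

(** Reads off from the image which branch of [bell_site] was taken, the first step in inverting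
    [bell_pair]. *)
Lemma ord_pred_bell_pair x :
  (ord_pred (bell_pair x).1 \in (bell_pair x).2) = (x.1 \in x.2).
Proof.
case: x => i S; rewrite /bell_pair /bell_site /=.
case: (boolP (i \in S)) => iS; first by rewrite inE /bellb eqxx /= iS orbT.
by rewrite ordSK bell_set_notin // (negbTE iS).
Qed.

Lemma bell_pair_inj : injective bell_pair.
Proof.
move=> [i S] [i' S'] e.
have := ord_pred_bell_pair (i, S); rewrite e ord_pred_bell_pair /=.
case: (boolP (i \in S)) => iS iS'; move: e; rewrite /bell_pair /bell_site /= iS' ?iS.
  move=> [ei]; rewrite -{}ei in iS' * => eS; congr pair; apply/setP => j.
  (* When [i] is in the set, the bell stores the bit of [ord_pred i] at [i]. *)
  have memE (T : {set 'I_N}) : i \in T -> (j \in T) =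
      if j == i then true else if j == ord_pred i then i \in bell_set i T
      else j \in bell_set i T.
    move=> iT; have [->//|ni] := eqVneq j i.
    have [ej|np] := eqVneq j (ord_pred i); rewrite inE /bellb.
      by rewrite -ej [i == j]eq_sym (negbTE ni) eqxx /= iT andbT.
    by rewrite (negbTE np) (negbTE ni).
  by rewrite memE // [RHS]memE // eS.
rewrite (negbTE iS) => e.
have ei := ordS_inj (congr1 fst e); have := congr1 snd e.
by rewrite /= !bell_set_notin // ?iS' // => ->; rewrite ei.
Qed.

End Lines.

(** * Multiline queue weights *)

Section Weight.

Variables (N : nat) (s : nat -> nat).
Hypothesis s_homo : {homo s : i j / i <= j}.

(** The number of multiline queues with line sizes [s 0], ..., [s (n - 1)] that produce the
    configuration. *)
Fixpoint weight n : conf n N -> nat :=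
  match n with
  | 0 => fun=> 1
  | m.+1 => fun u => \sum_(S : {set 'I_N} | #|S| == s m)
                       \sum_(v | mq v S == u) weight v
  end.

(** Threshold [k] is created by line [k] with [s k] sites; later lines are at least as large, so no
    customer is lost. *)
Lemma weight_count n (u : conf n N) k :
  weight u != 0 -> k < n -> count_le u k = s k.
Proof.
elim: n u k => // n IH u k /=.
rewrite sum_nat_eq0 negb_forall_in => /exists_inP[S /eqP cS].
rewrite sum_nat_eq0 negb_forall_in => /exists_inP[v /eqP <- wv].
rewrite ltnS /count_le => le_kn.
under eq_bigr do rewrite mq_le //.
move: le_kn; rewrite leq_eqVlt => /orP[/eqP ->|lt_kn].
  rewrite -cS -sum_mem; apply: eq_bigr => j _.
  by rewrite served_all // => i; rewrite -ltnS.
have := IH v k wv lt_kn; rewrite /count_le => ck.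
rewrite served_card // ck sum_mem cS; apply: s_homo; exact: ltnW.
Qed.

Lemma sum_weight n : \sum_(u : conf n N) weight u = \prod_(k < n) 'C(N, s k).
Proof.
elim: n => [|n IH] /=.
  rewrite big_ord0 sum1_card card_ffun !card_ord; exact: exp1n.
rewrite exchange_big big_ord_recr /= -IH mulnC.
rewrite -[X in 'C(X, _)](card_ord N) -card_draws -sum_nat_const.
rewrite [RHS](eq_bigl (fun S : {set 'I_N} => #|S| == s n)); last by move=> S; rewrite inE.
apply: eq_bigr => S _; rewrite [RHS](partition_big (fun v : conf n N => mq v S) predT) //=.
Qed.

Lemma weight_balance n (x : conf n N) :
  \sum_(i < N) \sum_(u | ring_bell i u == x) weight u = N * weight x.
Proof.
elim: n x => [|n IH] x /=.
  transitivity (\sum_(i < N) 1); last by rewrite sum1_card card_ord muln1.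
  have one (y z : conf 0 N) : y = z by apply/ffunP => j; rewrite !ord1.
  apply: eq_bigr => i _; rewrite (eq_bigl (pred1 x)) ?big_pred1_eq // => y /=.
  by rewrite (one (ring_bell i y) x) (one y x) !eqxx.
transitivity (\sum_(i < N) \sum_(S : {set 'I_N} | #|S| == s n)
    \sum_(v | ring_bell i (mq v S) == x) weight v).
  apply: eq_bigr => i _; rewrite exchange_big; apply: eq_bigr => S _ /=.
  rewrite [RHS](partition_big (fun v : conf n N => mq v S)
    (fun u => ring_bell i u == x)) //=.
  apply: eq_bigr => u /eqP <-; apply: eq_bigl => v.
  by case: (_ =P u) => [->|]; rewrite ?eqxx ?andbF.
(* Trade the bell on departures for bells on arrivals and services. [mq_bell] needs enough services,
   which [weight_count] provides wherever the weight is nonzero. *)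
transitivity (\sum_(y : 'I_N * {set 'I_N} | #|y.2| == s n)
    \sum_(v | mq (ring_bell (bell_pair y).1 v) (bell_pair y).2 == x) weight v).
  rewrite pair_big_dep /=; apply: eq_bigr => -[i S] /= /eqP cS.
  rewrite big_mkcond [RHS]big_mkcond; apply: eq_bigr => v _.
  have [->|wv] := eqVneq (weight v) 0; first by rewrite !if_same.
  rewrite mq_bell // => k lt_kn.
  by rewrite (weight_count wv lt_kn) cS; apply: s_homo; exact: ltnW.
(* [bell_pair] permutes the pairs and preserves the size of the service set. *)
transitivity (\sum_(y : 'I_N * {set 'I_N} | #|y.2| == s n)
    \sum_(v | mq (ring_bell y.1 v) y.2 == x) weight v).
  rewrite [RHS](reindex_inj (@bell_pair_inj N)) /=.
  by apply: eq_bigl => -[i S]; rewrite /= card_bell_set.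
rewrite -(pair_big_dep predT (fun _ (S : {set 'I_N}) => #|S| == s n)
  (fun i S => \sum_(v | mq (ring_bell i v) S == x) weight v)) /=.
rewrite exchange_big big_distrr /=; apply: eq_bigr => S _.
(* With [S] fixed, only the arrivals are rung, and the induction hypothesis applies. *)
transitivity (\sum_(y | mq y S == x)
    \sum_(i < N) \sum_(v | ring_bell i v == y) weight v).
  rewrite exchange_big; apply: eq_bigr => i _ /=.
  rewrite (partition_big (fun v : conf n N => ring_bell i v)
    (fun u => mq u S == x)) //=.
  apply: eq_bigr => u /eqP <-; apply: eq_bigl => v.
  by case: (_ =P u) => [->|]; rewrite ?eqxx ?andbF.
rewrite big_distrr /=; apply: eq_bigr => y _; exact: IH.
Qed.

Definition services n (u : conf n.+1 N) := [set j | u j <= n].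

(** The last line is forced to be the set of occupied sites. *)
Lemma weightS n (u : conf n.+1 N) : count_le u n = s n ->
  weight u = \sum_(v | mq v (services u) == u) weight v.
Proof.
move=> cu /=; rewrite (bigD1 (services u)) /=; last first.
  by rewrite -sum_mem -cu; apply/eqP; apply: eq_bigr => j _; rewrite inE.
rewrite [X in _ + X]big1 ?addn0 // => S /andP[_ /eqP nS].
rewrite big1 // => v /eqP eu; case: nS.
by apply/setP => j; rewrite inE -eu mq_service.
Qed.

Definition drop_last n (u : conf n.+1 N) : conf n N := [ffun j => inord (minn (u j) n)].

Lemma drop_lastE n (u : conf n.+1 N) j : drop_last u j = minn (u j) n :> nat.
Proof. by rewrite ffunE inordK // ltnS geq_minr. Qed.

Lemma drop_last_le n (u : conf n.+1 N) k j : k < n ->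
  (drop_last u j <= k) = (u j <= k).
Proof. by move=> lt_kn; rewrite drop_lastE; lia. Qed.

Lemma mq_drop_last n (u : conf n.+1 N) : mq (drop_last u) (services u) = u.
Proof.
apply: conf_eq => k j; rewrite ltnS => le_kn; rewrite mq_le //.
move: le_kn; rewrite leq_eqVlt => /orP[/eqP ->|lt_kn].
  rewrite served_all; last by move=> i; rewrite -ltnS.
  by rewrite -[LHS]/(j \in services u) inE.
rewrite served_sub ?drop_last_le // => i; rewrite drop_last_le // => le.
rewrite -[mem _ _]/(i \in services u) inE; exact: leq_trans le (ltnW lt_kn).
Qed.

(** The descent condition of the theorem, with a hole read as class [n + 1]. *)
Definition slow_descent n (u : conf n N) := [forall j, u j <= (u (ordS j)).+1].

(* If some arrival with value at most [k] waited, it would start waiting at a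
   hole, and the first service after this hole would go to a value at most [k],
   an excessive descent. *)
Lemma slow_descent_no_wait n (u : conf n.+1 N) (v : conf n N) k :
  slow_descent u -> mq v (services u) = u -> k < n ->
  count_le v k <= #|services u| ->
  forall j, backlog (fun i => v i <= k) (mem (services u)) j = 0.
Proof.
move=> /forallP desc eu lt_kn; rewrite -sum_mem => le_card.
pose A i := v i <= k; pose S : pred 'I_N := mem (services u); pose q := backlog A S.
rewrite -/A -/S -/q.
have qq : queue A S q by exact: backlog_queue.
have SE i : S i = (u i <= n) by rewrite -[S i]/(i \in services u) inE.
have dep i : S i -> 0 < q (ord_pred i) -> u i <= k.
  move=> Si qi; rewrite -eu mq_le ?(ltnW lt_kn) // /served /departs -/A -/S -/q.
  by rewrite Si addn_gt0 qi.
have step i : ~~ S (ord_pred i) -> 0 < q (ord_pred i) -> ~~ S i /\ 0 < q i.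
  move=> nSp qp; have nSi : ~~ S i.
    apply/negP => Si; have := dep i Si qp; move: nSp; rewrite SE.
    by have := desc (ord_pred i); rewrite ord_predK; lia.
  by split=> //; rewrite qq (negbTE nSi) subn0 addn_gt0 qp.
(* Waiting at one hole would spread around the cycle and leave no service at all, hence no arrival
   by [le_card]. *)
have [[i /andP[nSi qi]]|nex] := pselect (exists i, ~~ S i && (0 < q i)).
  have nS j : ~~ S j.
    suff : ~~ S j /\ 0 < q j by case.
    by apply: (@cycle_ind N (fun j => ~~ S j /\ 0 < q j) i) => // l [] /step h /h.
  have S0 : \sum_j S j = 0 by apply: big1 => j _; rewrite (negbTE (nS j)).
  move=> j; apply: backlog_sub => l Al; exfalso.
  by move: le_card; rewrite -/S S0 /count_le (bigD1 l) //= -/(A l) Al.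
have busy i : 0 < q i -> S i.
  by move=> qi; apply/negPn/negP => nSi; apply: nex; exists i; rewrite nSi.
move=> j; apply/eqP; rewrite -leqn0 leqNgt; apply/negP => qj.
(* An empty queue stays empty, since waiting begins only at a hole. So if someone waits, the queue
   is empty nowhere and every site is a service. *)
have allS l : S l.
  apply/busy; rewrite lt0n; apply/negP => q0.
  suff : q j == 0 by rewrite -leqn0 leqNgt qj.
  apply: (@cycle_ind N (fun x => q x == 0) l) => // x /eqP qx.
  apply/eqP; have := busy x; rewrite qq qx add0n.
  by case: (A x) (S x) => -[] //= /(_ isT).
suff : q j = 0 by move=> q0; rewrite q0 in qj.
by apply: backlog_sub => l _; exact: allS.
Qed.

Lemma weight_min n (u : conf n N) : (forall k, k < n -> count_le u k = s k) ->
  0 < weight u /\ (weight u == 1) = slow_descent u.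
Proof.
elim: n u => [|n IH] u cu.
  by split=> //; apply/esym/forallP => j; rewrite [u j]ord1.
pose v := drop_last u.
have cv k : k < n -> count_le v k = s k.
  move=> lt_kn; rewrite -cu; last exact: ltnW.
  by apply: eq_bigr => j _; rewrite drop_last_le.
have [wv wv1] := IH v cv.
have cS : #|services u| = s n.
  by rewrite -cu // -sum_mem; apply: eq_bigr => j _; rewrite inE.
have le_cS (w : conf n N) k : k < n -> count_le w k = s k -> count_le w k <= #|services u|.
  by move=> lt_kn ->; rewrite cS; apply: s_homo; exact: ltnW.
rewrite weightS ?cu // (bigD1 v) ?mq_drop_last //=; set rest := \sum_(_ | _) _.
split; first by rewrite addn_gt0 wv.
case: (boolP (slow_descent u)) => du.
  have dv : slow_descent v.
    apply/forallP => j; move/forallP/(_ j): du; rewrite !drop_lastE; lia.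
  rewrite dv in wv1; rewrite (eqP wv1) /rest big1 // => w /andP[/eqP ew nw].
  (* Without waiting, every customer of [w] departs where it arrives, so [w] agrees with [u] below
     threshold [n], as [v] does. *)
  apply: contraNeq nw => ww; apply/eqP; apply: conf_eq => k j lt_kn.
  have cw := weight_count ww lt_kn.
  rewrite drop_last_le // -[in RHS]ew mq_le ?(ltnW lt_kn) //.
  have q0 := slow_descent_no_wait du ew lt_kn (le_cS w k lt_kn cw).
  rewrite /served /departs q0 add0n.
  have := backlog_queue (A := fun i => w i <= k) (S := mem (services u)).
  rewrite sum_mem => /(_ (le_cS w k lt_kn cw) j); rewrite !q0 add0n.
  by case: (w j <= k); case: (mem _ j).
case: (boolP (slow_descent v)) => dv; rewrite ?(negbTE dv) ?dv in wv1; last first.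
  by apply/negbTE; move: wv wv1; case: (weight v) => [|[|m]].
have [j uj] : exists j, ~~ (u j <= (u (ordS j)).+1) by apply/existsP; rewrite -negb_forall.
(* Merging the last class with the holes removes the violation, so [u j] is a hole and [u (ordS j)]
   has value [n - 1]. *)
have vj := forallP dv j; rewrite !drop_lastE in vj.
have nS : j \notin services u by rewrite inE; move: uj vj; lia.
(* The second preimage: by [mq_bell] at [j], it produces [ring_bell j u], which is [u] because [j]
   is a hole. *)
pose w := ring_bell (ordS j) v.
have cw k : k < n -> count_le w k = s k by rewrite count_le_bell; exact: cv.
have ew : mq w (services u) = u.
  have := @mq_bell N n v (services u) j (fun k lt => le_cS v k lt (cv k lt)).
  rewrite /bell_site -[mem _ _]/(j \in services u) (negbTE nS) bell_set_notin // => ->.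
  rewrite mq_drop_last; apply: conf_eq => k l lt_kn; rewrite ring_bell_le /bellb.
  have Fj : (u j <= k) = false by move: nS; rewrite inE; lia.
  rewrite Fj orbF andbF; case: eqP => [->//|_].
  by case: eqP => [->|].
have nwv : w != v.
  apply/eqP => /ffunP /(_ j); rewrite /w /ring_bell ffunE ordSK eqxx.
  rewrite /Order.min ltEord => /(congr1 (@nat_of_ord _)).
  case: ifP; rewrite !drop_lastE; have := ltn_ord (u j); move: uj vj; lia.
have [ww _] := IH w cw.
suff : 0 < rest by move=> r0; apply/eqP; move: wv r0; lia.
by rewrite /rest (bigD1 w) /= ?ew ?nwv ?eqxx // addn_gt0 ww.
Qed.

End Weight.

(** * Uniqueness of the invariant measure *)

Section Sorted.

Variables (n N : nat).
Implicit Types u : conf n N.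

Definition sorted_conf u := forall i : 'I_N, 0 < i -> u (ord_pred i) <= u i.

Lemma val_ord_pred (i : 'I_N) : 0 < i -> ord_pred i = i.-1 :> nat.
Proof.
move=> i0 /=; have := ltn_ord i => iN.
have -> : (i + N).-1 = i.-1 + N by lia.
by rewrite modnDr modn_small //; lia.
Qed.

Lemma sorted_conf_mono u : sorted_conf u ->
  forall i j : 'I_N, i <= j -> u i <= u j.
Proof.
move=> su i j; have [m] := ubnP j; elim: m j => // m IH j le_jm le_ij.
move: le_ij; rewrite leq_eqVlt => /orP[/eqP/val_inj -> //|lt_ij].
have j0 : 0 < j by lia.
have vp := val_ord_pred j0.
by apply: leq_trans (su j j0); apply: IH; rewrite vp; lia.
Qed.

(** In a sorted configuration the sites of value at most [k] form the initial segment of length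
    [count_le u k]. *)
Lemma sorted_conf_unique u v : sorted_conf u -> sorted_conf v ->
  (forall k, k < n -> count_le u k = count_le v k) -> u = v.
Proof.
have pos w k (j : 'I_N) : sorted_conf w -> (w j <= k) = (j < count_le w k).
  move=> sw; have := @sum_negb_leq N (fun i => ~~ (w i <= k)) j.
  rewrite ltnNge; under eq_bigr do rewrite negbK.
  rewrite -/(count_le w k) => ->; first by rewrite negbK.
  move=> i i' le; apply: contra => /(leq_trans _); apply; exact: sorted_conf_mono.
move=> su sv cuv; apply: conf_eq => k j lt_kn.
by rewrite !pos // cuv.
Qed.

(** Grows whenever a bell away from site 0 moves a larger value forward; its maximisers in a set
    closed under bells are therefore sorted. *)
Definition potential u := \sum_(j < N) j * u j.

Lemma potential_bell u (i : 'I_N) : 0 < i -> u i < u (ord_pred i) ->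
  potential u < potential (ring_bell i u).
Proof.
move=> i0 desc; have vp := val_ord_pred i0.
have npi : i != ord_pred i by apply/negP => /eqP /(congr1 (@nat_of_ord N)); lia.
rewrite /potential (bigD1 i) // (bigD1 (ord_pred i)) 1?eq_sym //=.
rewrite [ltnRHS](bigD1 i) // [X in _ < _ + X](bigD1 (ord_pred i)) 1?eq_sym //=.
rewrite !addnA -/(ord_pred i).
set a := \sum_(_ | _) _; set b := \sum_(_ | _) _.
have -> : b = a.
  apply: eq_bigr => j /andP[ji jp]; by rewrite /ring_bell ffunE (negbTE ji) (negbTE jp).
rewrite ltn_add2r /ring_bell !ffunE (negbTE npi) !eqxx.
rewrite /Order.max /Order.min ltEord.
rewrite -/(ord_pred i) !ltnNge (ltnW desc) /=.
rewrite -[(i + N).-1 %% N]/(nat_of_ord (ord_pred i)) vp.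
move: desc; case: (nat_of_ord i) i0 => // m _ /=; nia.
Qed.

End Sorted.

Local Open Scope ring_scope.

Section Balance.

Variables (R : realFieldType) (n N : nat).
Implicit Types f : conf n N -> R.

Definition inflow f v := \sum_(i < N) \sum_(u | ring_bell i u == v) f u.

(** The equation [mu Q = 0], with bells that change nothing counted on both sides. *)
Definition balanced f := forall v, inflow f v = N%:R * f v.

Lemma sum_inflow f : \sum_v inflow f v = N%:R * \sum_u f u.
Proof.
rewrite exchange_big /= (eq_bigr (fun=> \sum_u f u)) => [|i _].
  by rewrite sumr_const card_ord mulr_natl.
by rewrite [RHS](partition_big (ring_bell i) predT).
Qed.

Lemma balanced_opp f : balanced f -> balanced (fun u => - f u).
Proof.
move=> bf v; rewrite mulrN -bf /inflow -sumrN; apply: eq_bigr => i _.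
by rewrite sumrN.
Qed.

(** The inflow of the positive part dominates pointwise, and the totals agree, so equality holds
    everywhere. *)
Lemma balanced_pos f : balanced f -> balanced (fun u => Num.max (f u) 0).
Proof.
move=> bf; set g := fun u => _.
have g0 u : 0 <= g u by rewrite /g le_max lexx orbT.
have fg u : f u <= g u by rewrite /g le_max lexx.
have ge v : 0 <= inflow g v - N%:R * g v.
  rewrite subr_ge0 /g maxr_pMr ?ler0n // mulr0 ge_max -bf; apply/andP; split.
    by apply: ler_sum => i _; apply: ler_sum.
  by apply: sumr_ge0 => i _; apply: sumr_ge0 => u _; exact: g0.
move=> v; apply/eqP; rewrite -subr_eq0; apply/eqP.
have /psumr_eq0P -> // : forall v, predT v -> 0 <= inflow g v - N%:R * g v by [].
by rewrite sumrB sum_inflow -mulr_sumr subrr.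
Qed.

Lemma balanced_bell f u i : (forall u, 0 <= f u) -> balanced f ->
  f u != 0 -> f (ring_bell i u) != 0.
Proof.
move=> f0 bf; apply: contraNneq => fb; have := bf (ring_bell i u).
rewrite fb mulr0 /inflow => /psumr_eq0P h.
have {}h := h (fun j _ => sumr_ge0 _ (fun u _ => f0 u)) i isT.
by move/psumr_eq0P: h => -> //.
Qed.

Lemma balanced_sorted f u : (forall u, 0 <= f u) -> balanced f ->
  f u != 0 -> exists2 w, f w != 0 & sorted_conf w.
Proof.
move=> f0 bf fu.
case: (@arg_maxnP _ u (fun u => f u != 0) (@potential n N) fu) => w fw wmax.
exists w => // i i0; rewrite leqNgt; apply/negP => desc.
have := wmax _ (balanced_bell i f0 bf fw).
by rewrite /= leqNgt potential_bell.
Qed.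

(* The positive and negative parts of [f] are both balanced; were they both
   nonzero, each would charge the sorted configuration. *)
Lemma balanced_unique f (s : nat -> nat) : balanced f ->
  (forall u k, f u != 0 -> (k < n)%N -> count_le u k = s k) ->
  \sum_u f u = 0 -> forall u, f u = 0.
Proof.
move=> bf supp sum0.
pose g u := Num.max (f u) 0; pose h u := Num.max (- f u) 0.
have bg : balanced g by exact: balanced_pos.
have bh : balanced h by exact: (balanced_pos (balanced_opp bf)).
have g0 u : 0 <= g u by rewrite /g le_max lexx orbT.
have h0 u : 0 <= h u by rewrite /h le_max lexx orbT.
have gf u : g u != 0 -> 0 < f u.
  by rewrite /g; apply: contra_neqT; rewrite -leNgt => /max_idPr.
have hf u : h u != 0 -> f u < 0.
  by rewrite /h; apply: contra_neqT; rewrite -leNgt -oppr_le0 => /max_idPr.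
have [[u gu]|ng] := pselect (exists u, g u != 0).
  have [w gw sw] := balanced_sorted g0 bg gu.
  have [[u' hu]|nh] := pselect (exists u, h u != 0).
    have [w' hw sw'] := balanced_sorted h0 bh hu.
    suff e : w = w' by have := gf _ gw; have := hf _ hw; rewrite -e; lra.
    apply: sorted_conf_unique => // k lt_kn.
    rewrite (supp w) ?(supp w') //; first by rewrite lt_eqF // hf.
    by rewrite gt_eqF // gf.
  have f0 u' : true -> 0 <= f u'.
    by move=> _; rewrite leNgt; apply/negP => fu; apply: nh; exists u';
       rewrite /h max_l ?oppr_eq0 ?lt_eqF // oppr_ge0 ltW.
  by move/psumr_eq0P: sum0 => /(_ f0) h1 v; exact: h1.
have f0 u' : true -> 0 <= - f u'.
  by move=> _; rewrite oppr_ge0 leNgt; apply/negP => fu; apply: ng; exists u';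
     rewrite /g max_l ?gt_eqF // ltW.
have : \sum_u - f u = 0 by rewrite sumrN sum0 oppr0.
by move/psumr_eq0P => /(_ f0) h1 v; apply/eqP; rewrite -oppr_eq0 h1.
Qed.

End Balance.

Local Open Scope classical_set_scope.

(** * From invariance under the semigroup to the balance equation *)

Section Generator.

Variables (R : realType).

(** For [t] in (0,1] the terms of order at least 2 sum to at most [t ^+ 2 * expR L]; a constant sum
    thus bounds the linear coefficient by a multiple of [t]. *)
Lemma coef1_eq0 (g : nat -> R) (L : R) : 0 <= L ->
  (forall k, `|g k| <= L ^+ k) ->
  (forall t : R, 0 <= t ->
     limn (series (fun k => t ^+ k / k`!%:R * g k)) = g 0%N) -> g 1%N = 0.
Proof.
move=> L0 gL hlim.
have bound t : 0 < t -> t <= 1 -> `|g 1%N| <= t * expR L.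
  move=> t0 t1; pose a k := t ^+ k / k`!%:R * g k.
  have aL k : `|a k| <= t ^+ k * exp_coeff L k.
    rewrite /a /exp_coeff /= !normrM normrX (gtr0_norm t0) normfV.
    rewrite (@ger0_norm _ k`!%:R) // -mulrA ler_pM2l ?exprn_gt0 //.
    by rewrite mulrC ler_pM2r ?gL // invr_gt0 ltr0n fact_gt0.
  have tk k : t ^+ k <= 1 by apply: exprn_ile1 => //; exact: ltW.
  have ca : cvgn (series a).
    apply: normed_cvg; apply: (series_le_cvg _ _ _ (is_cvg_series_exp_coeff L)).
    - by move=> k /=.
    - by move=> k; exact: exp_coeff_ge0.
    - move=> k /=; apply: le_trans (aL k) _.
      by rewrite ler_piMl ?exp_coeff_ge0.
  have part m : `|series a m.+2 - (g 0%N + t * g 1%N)| <= t ^+ 2 * expR L.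
    have a0 : a 0%N = g 0%N by rewrite /a expr0 fact0 invr1 !mul1r.
    have a1 : a 1%N = t * g 1%N by rewrite /a expr1 divr1.
    rewrite /series /= big_mkord !big_ord_recl /= -[bump 0 0]/1%N a0 a1.
    have -> : forall x y z : R, x + (y + z) - (x + y) = z by move=> x y z; ring.
    apply: le_trans (ler_norm_sum _ _ _) _.
    apply: (@le_trans _ _ (t ^+ 2 * series (exp_coeff L) m.+2)).
      rewrite /series /= big_mkord !big_ord_recl /= !mulrDr.
      rewrite addrA ler_wpDl //.
        by rewrite addr_ge0 // mulr_ge0 ?exp_coeff_ge0 // exprn_ge0 // ltW.
      rewrite mulr_sumr; apply: ler_sum => k _; apply: le_trans (aL _) _.
      rewrite ler_wpM2r ?exp_coeff_ge0 // /bump /= !add1n -addn2 exprD.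
      by rewrite ler_piMl ?exprn_ge0 // ltW.
    rewrite ler_pM2l ?exprn_gt0 // /expR.
    apply: nondecreasing_cvgn_le; last exact: is_cvg_series_exp_coeff.
    apply: nondecreasing_series => k _ _; exact: exp_coeff_ge0.
  have : `|g 0%N - (g 0%N + t * g 1%N)| <= t ^+ 2 * expR L.
    have <- := hlim t (ltW t0); rewrite -/a.
    have cb : (fun k => series a k - (limn (series a) + t * g 1%N)) @ \oo
       --> limn (series a) - (limn (series a) + t * g 1%N).
      by apply: cvgB => //; exact: cvg_cst.
    apply: (cvgr_to_le (cvg_norm cb)).
    exists 2%N => // -[|[|m]] //= _.
    have -> : limn (series a) = g 0%N by exact: hlim (ltW t0).
    exact: part.
  have -> : forall x y : R, x - (x + y) = - y by move=> x y; ring.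
  rewrite normrN normrM (gtr0_norm t0) expr2 -mulrA.
  by rewrite ler_pM2l.
apply/eqP; rewrite -normr_eq0; apply/eqP.
have E0 := expR_gt0 L.
have G0 := normr_ge0 (g 1%N).
apply/eqP; rewrite eq_le G0 andbT leNgt; apply/negP => Gpos.
set E := expR L in bound E0; set G := `|g 1%N| in bound G0 Gpos.
have D0 : 0 < G + 2 * E by lra.
(* This [t] lies in (0,1] and would give [G + 2 * E <= E]. *)
have := bound (G / (G + 2 * E)).
rewrite divr_gt0 // ler_pdivrMr // mul1r => /(_ isT).
have -> : G <= G + 2 * E by lra.
by move=> /(_ isT); rewrite mulrAC ler_pdivlMr //; nra.
Qed.

(** The geometric growth of the iterates of [gen] required by [coef1_eq0]. *)
Lemma gen_norm n N (mu : conf n N -> R) :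
  \sum_v `|gen mu v| <= (N%:R + N%:R) * \sum_v `|mu v|.
Proof.
pose nmu v := `|mu v|.
apply: (@le_trans _ _ (\sum_v (inflow nmu v + N%:R * nmu v))).
  apply: ler_sum => v _; rewrite /gen sumrB sumr_const card_ord.
  apply: le_trans (ler_normB _ _) _; apply: lerD; last by rewrite normrMn mulr_natl.
  apply: le_trans (ler_norm_sum _ _ _) _; apply: ler_sum => i _.
  exact: ler_norm_sum.
by rewrite big_split /= sum_inflow -mulr_sumr mulrDl.
Qed.

Lemma stationary_balanced n N (p : 'I_n -> nat) (mu : conf n N -> R) :
  stationary_distribution p mu -> balanced mu.
Proof.
move=> [mu0 mu1 _ hlaw] v.
have iter_norm k : \sum_v `|iter k (@gen R n N) mu v| <= (N%:R + N%:R) ^+ k.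
  elim: k => [|k IH] /=.
    by rewrite (eq_bigr mu) ?mu1 // => u _; rewrite ger0_norm.
  apply: le_trans (gen_norm _) _; rewrite exprS ler_wpM2l // addr_ge0 //.
have : gen mu v = 0.
  apply: (@coef1_eq0 (fun k => iter k (@gen R n N) mu v) (N%:R + N%:R)).
  - by rewrite addr_ge0.
  - move=> k; apply: le_trans (iter_norm k); rewrite (bigD1 v) //= lerDl.
    by apply: sumr_ge0.
  - by move=> t t0; exact: hlaw.
rewrite /gen sumrB sumr_const card_ord => /eqP; rewrite subr_eq0 => /eqP e.
by rewrite /inflow e mulr_natl.
Qed.

End Generator.

(** * The stationary distribution as normalised weight *)

Section Stationary.

Variables (R : realType) (n N : nat) (p : 'I_n -> nat).
Hypothesis psum_le : (\sum_(m < n) p m <= N)%N.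

Definition psum k := (\sum_(m < n | m <= k) p m)%N.

Lemma psum_homo : {homo psum : i j / (i <= j)%N}.
Proof.
move=> i j le_ij; rewrite /psum big_mkcond [X in (_ <= X)%N]big_mkcond /=.
apply: leq_sum => m _; case: ifP => // le_mi.
by rewrite (leq_trans le_mi le_ij).
Qed.

Lemma state_space_count (u : conf n N) k :
  u \in state_space N p -> (k < n)%N -> count_le u k = psum k.
Proof.
rewrite inE => /forallP pu lt_kn; rewrite /count_le /psum.
transitivity (\sum_(m < n | m <= k) \sum_(j | u j == Defs.class m) 1)%N; last first.
  by apply: eq_bigr => m _; rewrite -(eqP (pu m)) -sum1_card; apply: eq_bigl => j; rewrite inE.
rewrite (exchange_big_dep predT) //=; apply: eq_bigr => j _.
case: (leqP (u j) k) => [le_uk|lt_ku].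
  have lt_un := leq_ltn_trans le_uk lt_kn.
  rewrite (big_pred1 (Ordinal lt_un)) // => m /=.
  rewrite -!val_eqE /= eq_sym; case: eqP => [->|_]; by rewrite ?andbT ?andbF.
rewrite big_pred0 // => m; apply/negP => /andP[le_mk /eqP eu].
by move: lt_ku; rewrite eu /= ltnNge le_mk.
Qed.

Lemma M_gt0 : (0 < M N p)%N.
Proof.
apply: prodn_gt0 => k; rewrite bin_gt0; apply: leq_trans psum_le.
rewrite [X in (_ <= X)%N](bigID (fun m : 'I_n => (m <= k)%N)) /=; exact: leq_addr.
Qed.

(** The difference of the two sides is balanced, has total 0 and lives on configurations with counts
    [psum], so [balanced_unique] kills it. *)
Lemma stationary_weight (mu : conf n N -> R) : stationary_distribution p mu ->
  forall u, mu u = (weight psum u)%:R * (M N p)%:R^-1.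
Proof.
move=> hmu; have bmu := stationary_balanced hmu.
case: hmu => mu0 mu1 musupp _ u; apply/eqP; rewrite -subr_eq0; apply/eqP.
have M0 : (M N p)%:R != 0 :> R by rewrite pnatr_eq0 -lt0n M_gt0.
pose f u := mu u - (weight psum u)%:R * (M N p)%:R^-1.
apply: (@balanced_unique R n N f psum).
- move=> v; rewrite /f mulrBr -bmu mulrA -natrM -(weight_balance psum_homo).
  rewrite natr_sum mulr_suml -sumrB; apply: eq_bigr => i _.
  by rewrite natr_sum mulr_suml -sumrB.
- move=> w k fw lt_kn.
  have [ww|ww] := eqVneq (weight psum w) 0%N; last exact: (weight_count psum_homo ww).
  apply: state_space_count lt_kn; apply: contraNT fw => /musupp mw.
  by rewrite /f mw ww mul0r subr0.
- by rewrite sumrB mu1 -mulr_suml -natr_sum sum_weight divff ?subrr.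
Qed.

(** A hole has value [n], so its successor has value [n] or [n - 1]: a hole or label [n]. *)
Lemma slow_descentP (u : conf n N) :
  reflect (forall j : 'I_N,
        (u j = hole n -> u (ordS j) = hole n \/ label (u (ordS j)) = n) /\
        (u j <> hole n -> (label (u j) - 1 <= label (u (ordS j)))%N))
    (slow_descent u).
Proof.
apply: (iffP forallP) => h j; have := h j; rewrite /label subn1 /=.
  move=> le; split=> [uj|//].
  move: le; rewrite uj /= => le; have := ltn_ord (u (ordS j)).
  rewrite ltnS leq_eqVlt => /orP[/eqP e|lt]; first by left; apply: val_inj.
  by right; apply/eqP; rewrite eqn_leq lt.
have [uj [/(_ uj) h1 _]|uj [_]] := pselect (u j = hole n); last exact.
by case: h1; rewrite uj => ->.
Qed.

End Stationary.

Theorem theorem5p1 (R : realType) (n N : nat) (p : 'I_n -> nat)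
    (hn : (1 <= n)%N) (hN : (1 <= N)%N)
    (hp : forall m : 'I_n, (p m <= N)%N)
    (hsum : (\sum_(m < n) p m <= N)%N)
    (mu : conf n N -> R) (hmu : stationary_distribution p mu) :
  (forall u : conf n N, u \in state_space N p ->
     exists k : int, mu u = k%:~R * (M N p)%:R^-1) /\
  (forall u : conf n N, u \in state_space N p ->
     (M N p)%:R^-1 <= mu u /\
     (mu u = (M N p)%:R^-1 <->
      forall j : 'I_N,
        (u j = hole n -> u (ordS j) = hole n \/ label (u (ordS j)) = n) /\
        (u j <> hole n -> (label (u j) - 1 <= label (u (ordS j)))%N))).
Proof.
have muE := stationary_weight hsum hmu.
split=> u pu; first by exists (weight (psum p) u)%:Z; rewrite muE.
have [w0 w1] := weight_min (@psum_homo _ p) (fun k => state_space_count pu).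
have M0 : 0 < (M N p)%:R^-1 :> R by rewrite invr_gt0 ltr0n (M_gt0 hsum).
split; first by rewrite muE ler_peMl ?ler1n ?ltW.
rewrite muE -[X in _ = X <-> _]mul1r; split=> [/(mulIf (lt0r_neq0 M0)) e|h].
  by apply/slow_descentP; rewrite -w1 -(eqr_nat R) e.
have /slow_descentP : slow_descent u by apply/slow_descentP.
by move=> /slow_descentP; rewrite -w1 => /eqP ->.
Qed.
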